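(* Let $X$ be a completely regular topological space. The commutative ring $(\mathbb{H}_{nf}(X),\oplus,\otimes)$ of nearly finite Hausdorff continuous functions on $X$ is rationally complete.
   Context: Notation: $\overline{\mathbb{R}}=\mathbb{R}\cup\{\pm\infty\}$ and $\mathbb{I}\overline{\mathbb{R}}=\{[\underline{a},\overline{a}]:\underline{a},\overline{a}\in\overline{\mathbb{R}},\ \underline{a}\le\overline{a}\}$; $a\in\overline{\mathbb{R}}$ is identified with $[a,a]$. An interval function $f:X\to\mathbb{I}\overline{\mathbb{R}}$ is S-continuous if its graph $\{(x,y): x\in X,\ y\in f(x)\}$ is a closed subset of $X\times\overline{\mathbb{R}}$. For interval functions, $\varphi\subseteq f$ means $\varphi(x)\subseteq f(x)$ for all $x\in X$. An interval function $f$ is Hausdorff continuous (H-continuous) if it is S-continuous and minimal with respect to inclusion: whenever $\varphi:X\to\mathbb{I}\overline{\mathbb{R}}$ is S-continuous and $\varphi\subseteq f$, then $\varphi=f$. $\mathbb{H}(X)$ denotes the set of all H-continuous functions on $X$. An H-continuous function $f$ is nearly finite if the set $\Gamma_f=\{x\in X: -\infty\in f(x)\text{ or }+\infty\in f(x)\}$ is closed and nowhere dense in $X$. $\mathbb{H}_{nf}(X)$ is the set of all nearly finite H-continuous functions on $X$. Interval arithmetic: for $A,B\in\mathbb{I}\overline{\mathbb{R}}$, $A+B=\{a+b:a\in A,b\in B\}$ and $A\times B=\{ab:a\in A,b\in B\}$, with the ambiguities at infinity resolved so as to guarantee inclusion: $-\infty+(+\infty)=[-\infty,+\infty]$, $0\times(+\infty)=[0,+\infty]$,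 $0\times(-\infty)=[-\infty,0]$. Point-wise operations: $(f+g)(x)=f(x)+g(x)$, $(f\times g)(x)=f(x)\times g(x)$. Ring operations: for $f,g\in\mathbb{H}_{nf}(X)$, each of $f+g$ and $f\times g$ is S-continuous and contains exactly one H-continuous function; $f\oplus g$ is the unique H-continuous function contained in $f+g$, and $f\otimes g$ is the unique H-continuous function contained in $f\times g$. With these operations $\mathbb{H}_{nf}(X)$ is a commutative ring whose zero and identity are the constant functions $0$ and $1$. Rational completeness: let $B$ be a commutative ring with identity and $A$ a subring with the same identity. $B$ is a rational extension (ring of quotients) of $A$ if for every $b\in B$ the set $b^{-1}A=\{a\in A: ba\in A\}$ is rationally dense in $B$, i.e. no nonzero element of $B$ annihilates $b^{-1}A$. A commutative ring with identity is rationally complete if it has no proper rational extension.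
   Formalization: The products 0×(+∞) and 0×(−∞) are taken to be [−∞,+∞] instead of [0,+∞] and [−∞,0]; with the latter, f(x)=x and g(x)=1/|x|, g(0)=+∞ on the real line have no H-continuous function in f×g, so ⊗ is undefined. *)

(* Defs.v *)
From HB Require Import structures.
From mathcomp Require Import all_boot all_order all_algebra.
From mathcomp Require Import all_classical all_reals all_analysis.

Set Implicit Arguments.
Unset Strict Implicit.
Unset Printing Implicit Defensive.

Import Order.TTheory GRing.Theory Num.Theory.
Import numFieldNormedType.Exports.
Local Open Scope classical_set_scope.
Local Open Scope ring_scope.

Section RationalCompleteness.

(* [denominators A b] is the set written b^-1 A. *)
Definition denominators (B : comPzRingType) (A : set B) (b : B) : set B :=
  [set a | A a /\ A (b * a)].

Definition rationally_dense (B : comPzRingType) (D : set B) : Prop :=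
  forall c : B, (forall a, D a -> c * a = 0) -> c = 0.

Definition rational_extension (B : comPzRingType) (A : set B) : Prop :=
  forall b : B, rationally_dense (denominators A b).

(* Rings containing A as a subring with the same identity are presented as
   injective (unital) ring morphisms out of A.  The trivial ring is allowed,
   whence comPzRingType: it is the ring of functions on the empty space. *)
Definition rationally_complete (A : comPzRingType) : Prop :=
  forall (B : comPzRingType) (i : {rmorphism A -> B}),
    injective i -> rational_extension (range i) -> range i = setT.

End RationalCompleteness.

Section Intervals.
Context {R : realType}.

Definition is_interval_value (A : set (\bar R)) : Prop :=
  exists a b : \bar R, (a <= b)%E /\ A = [set y | (a <= y)%E /\ (y <= b)%E].

(* Set-valued sum of two extended reals; adde itself sets -oo + +oo := -oo,
   and setT = [-oo, +oo]. *)
Definition eadd_set (a b : \bar R) : set (\bar R) :=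
  if ((a == -oo) && (b == +oo) || (a == +oo) && (b == -oo))%E
  then setT else [set (a + b)%E].

(* Set-valued product of two extended reals.  The products 0 x (+oo) and
   0 x (-oo) are [-oo, +oo], the set of all limits of products, so that the
   pointwise product of S-continuous functions is S-continuous.  The
   half-lines [0, +oo] and [-oo, 0] would not do: for f(x) = x and
   g(x) = 1/|x|, g(0) = +oo, on the real line, the product is the sign of x
   for x <> 0, so an S-continuous function contained in f x g takes at 0 a
   value containing -1 and 1.  Any H-continuous function contained in the
   product formed with half-lines is contained in the present one. *)
Definition emul_set (a b : \bar R) : set (\bar R) :=
  if ((a == 0) && ((b == +oo) || (b == -oo))
      || (b == 0) && ((a == +oo) || (a == -oo)))%E
  then setT else [set (a * b)%E].

Definition iadd (A B : set (\bar R)) : set (\bar R) :=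
  \bigcup_(a in A) \bigcup_(b in B) eadd_set a b.

Definition imul (A B : set (\bar R)) : set (\bar R) :=
  \bigcup_(a in A) \bigcup_(b in B) emul_set a b.

End Intervals.

Section HausdorffContinuous.
Context {R : realType} {X : topologicalType}.
Implicit Types f g h phi : X -> set (\bar R).

Definition interval_function f : Prop := forall x, is_interval_value (f x).

Definition S_continuous f : Prop :=
  interval_function f /\ closed [set p : X * \bar R | f p.1 p.2].

Definition fun_incl phi f : Prop := forall x, phi x `<=` f x.

Definition H_continuous f : Prop :=
  S_continuous f /\
  forall phi, S_continuous phi -> fun_incl phi f -> phi = f.

Definition infinite_points f : set X := [set x | f x -oo%E \/ f x +oo%E].

Definition nowhere_dense (A : set X) : Prop := interior (closure A) = set0.

Definition nearly_finite f : Prop :=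
  closed (infinite_points f) /\ nowhere_dense (infinite_points f).

Definition Hcont_in f : set (X -> set (\bar R)) :=
  [set h | H_continuous h /\ fun_incl h f].

End HausdorffContinuous.

Definition Hnf (R : realType) (X : topologicalType) :
    set (X -> set (\bar R)) :=
  [set f | H_continuous f /\ nearly_finite f].
Arguments Hnf R X : clear implicits.

(* [is_Hnf_ring rho]: via rho, the ring A is the set Hnf R X equipped with
   oplus and otimes.  The equations with singletons say that the pointwise
   sum (product) contains exactly one H-continuous function, and that this
   function is the sum (product) in the ring. *)
Definition is_Hnf_ring (R : realType) (X : topologicalType)
    (A : comPzRingType) (rho : A -> X -> set (\bar R)) : Prop :=
  [/\ set_bij setT (Hnf R X) rho,
      rho 0 = (fun=> [set 0%E]),
      rho 1 = (fun=> [set 1%E]),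
      forall a b,
        Hcont_in (fun x => iadd (rho a x) (rho b x)) = [set rho (a + b)]
    & forall a b,
        Hcont_in (fun x => imul (rho a x) (rho b x)) = [set rho (a * b)]].

(* Main.v *)
Require Import Defs.
From HB Require Import structures.
From mathcomp Require Import all_boot all_order all_algebra.
From mathcomp Require Import all_classical all_reals all_analysis.
From mathcomp Require Import ring lra.

(** The ring of nearly finite H-continuous functions is a quotient of a ring
    of ordinary real functions with pointwise operations.  Let a property of
    points be generic when it holds on a dense open set.  A real function is
    called [gcont] when, for every [e > 0], generic points have a neighbourhood
    on which it stays within [e] of its value there, and [gnull] when, for
    every [e > 0], it is generically smaller than [e] in absolute value.  The
    [gcont] functions form a ring, and the [gnull] functions an ideal in it.

    The [envelope] of a real function is at each point the intersection of the
    closed intervals that contain its values generically near that point.  It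
    is S-continuous, and included in every S-continuous function to which the
    real function generically belongs ([envelope_incl]).  The envelope of a
    [gcont] function is H-continuous and nearly finite ([envelope_Hnf]).
    Conversely a nearly finite H-continuous function [f] is the envelope of
    each of its real selections, by minimality ([selection_envelope]), and
    such selections are [gcont] ([selection_gcont]).  Two [gcont] functions
    have the same envelope exactly when they differ by a [gnull] function.  So
    the nearly finite H-continuous functions are the [gcont] functions modulo
    the [gnull] ones, and inherit a ring structure.

    That this structure is the one given by oplus and otimes is
    [Hcont_in_lift].  The pointwise interval sum or product of two
    S-continuous functions is S-continuous because the extended operations
    have closed graphs and the extended line is compact; it contains the
    envelope of the sum or product of selections by [envelope_incl].  Any
    H-continuous function in it has generically a selection of the form
    [c + d] or [c * d], with [c] and [d] selections of the two operands, so it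
    is that envelope.

    Rational completeness rests on two facts about this ring.  It is von
    Neumann regular in a topological way: each element [a] has a
    quasi-inverse [a'] such that [a * a'] is the characteristic function of an
    open set [U], and [a * 1_U = a] ([hnf_quasi_inverse]).  And elements can be
    glued along open sets, because the value of an envelope at a point depends
    only on the germ of the function there.  Let [b] belong to a rational
    extension, and let [D] be the family of the open sets [O] such that
    [b * 1_O] lies in the ring.  By regularity and density of the
    denominators of [b], the union of [D] is dense.  The elements [b * 1_O]
    coincide as interval functions on overlaps, so their selections glue to
    one [gcont] function.  Its class agrees with [b] on every denominator,
    hence is [b]. *)
Set Implicit Arguments.
Unset Strict Implicit.
Unset Printing Implicit Defensive.

Import Order.TTheory GRing.Theory Num.Theory.
Import numFieldNormedType.Exports.
Local Open Scope classical_set_scope.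
Local Open Scope ring_scope.

(** * The extended real line and its closed intervals *)
Section ExtendedReals.
Context {R : realType}.
Implicit Types (x y p : \bar R) (A B C : set (\bar R)).

Lemma ereal_dense x y : (x < y)%E -> exists2 z : \bar R, (x < z)%E & (z < y)%E.
Proof.
move: x y => [x||] [y||] // xy.
- by exists ((x + y) / 2)%:E; rewrite !lte_fin midf_lt.
- by exists (x + 1)%:E; rewrite ?ltry// lte_fin ltrDl.
- by exists (y - 1)%:E; rewrite ?ltNyr// lte_fin ltrBlDr ltrDl.
- by exists 0%E; rewrite ?ltNyr// ltry.
Qed.

(** The topology of the extended line is the order topology.  Each of the two
    half-lines [P] and [Q] may be the whole line: this is needed at the ends. *)
Lemma nbhs_ereal_order p B : nbhs p B ->
  exists P Q : set (\bar R), [/\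
    P = setT \/ (exists2 s, (s < p)%E & P = [set y | (s < y)%E]),
    Q = setT \/ (exists2 s, (p < s)%E & Q = [set y | (y < s)%E])
    & P `&` Q `<=` B].
Proof.
case: p => [r||] /=.
- move=> [e /= e0 rB].
  exists [set y | ((r - e)%:E < y)%E], [set y | (y < (r + e)%:E)%E]; split.
  + by right; exists (r - e)%:E => //; rewrite lte_fin ltrBlDr ltrDl.
  + by right; exists (r + e)%:E => //; rewrite lte_fin ltrDl.
  + move=> [y||] /= [].
    * by rewrite !lte_fin => ry yr; apply: rB; rewrite /= distrC ltr_distl ry yr.
    * by move=> _; rewrite ltNge leey.
    * by rewrite ltNge leNye.
- move=> [M [_ MB]]; exists [set y | (M%:E < y)%E], setT; split.
  + by right; exists M%:E => //; rewrite ltry.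
  + by left.
  + by move=> y [My _]; exact: MB.
- move=> [M [_ MB]]; exists setT, [set y | (y < M%:E)%E]; split.
  + by left.
  + by right; exists M%:E => //; rewrite ltNyr.
  + by move=> y [_ My]; exact: MB.
Qed.

(** An ultrafilter [F] converges to the supremum of the [t] such that
    [F] contains the half-line above [t]. *)
Lemma ereal_compact : compact [set: \bar R].
Proof.
rewrite compact_ultra => F UF _.
pose p := ereal_sup [set t | F [set y | (t <= y)%E]].
exists p; split=> // B /nbhs_ereal_order [P [Q [hP hQ PQB]]].
apply: (filterS PQB); apply: filterI.
- case: hP => [->|[s /ereal_sup_gt [t /= Ft st] ->]]; first exact: filterT.
  by apply: filterS Ft => y /=; exact: lt_le_trans.
- case: hQ => [->|[s ps ->]]; first exact: filterT.
  have [//|Fs] := in_ultra_setVsetC [set y | (y < s)%E] UF.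
  exfalso; move: ps; rewrite ltNge => /negP; apply.
  apply: ereal_sup_ubound; apply: filterS Fs => y /= /negP.
  by rewrite -leNgt.
Qed.

Lemma closed_ereal_compact A : closed A -> compact A.
Proof.
by move=> cA; exact: subclosed_compact cA ereal_compact (@subsetT _ _).
Qed.

Lemma closed_ereal_inf A : closed A -> A !=set0 -> A (ereal_inf A).
Proof.
move=> cA [a Aa]; apply: contrapT => nA.
have /nbhs_ereal_order [P [Q [hP hQ PQ]]] : nbhs (ereal_inf A) (~` A).
  by apply: open_nbhs_nbhs; split => //; exact: closed_openC.
have AP y : A y -> P y.
  move=> Ay; case: hP => [->//|[s sp ->]] /=.
  by apply: lt_le_trans sp _; exact: ereal_inf_lbound.
case: hQ => [QT|[s /ereal_inf_lt[b Ab bs] Qs]].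
- by apply: (PQ a) => //; rewrite QT; split => //; exact: AP.
- by apply: (PQ b) => //; rewrite Qs; split => //; exact: AP.
Qed.

Lemma closed_ereal_sup A : closed A -> A !=set0 -> A (ereal_sup A).
Proof.
move=> cA [a Aa]; apply: contrapT => nA.
have /nbhs_ereal_order [P [Q [hP hQ PQ]]] : nbhs (ereal_sup A) (~` A).
  by apply: open_nbhs_nbhs; split => //; exact: closed_openC.
have AQ y : A y -> Q y.
  move=> Ay; case: hQ => [->//|[s sp ->]] /=.
  by apply: le_lt_trans sp; exact: ereal_sup_ubound.
case: hP => [PT|[s /ereal_sup_gt[b Ab bs] Ps]].
- by apply: (PQ a) => //; rewrite PT; split => //; exact: AQ.
- by apply: (PQ b) => //; rewrite Ps; split => //; exact: AQ.
Qed.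

Lemma closed_convex_interval A : closed A -> A !=set0 ->
  (forall x y z, A x -> A z -> (x <= y)%E -> (y <= z)%E -> A y) ->
  is_interval_value A.
Proof.
move=> cA A0 cvA; exists (ereal_inf A), (ereal_sup A).
have Ai := closed_ereal_inf cA A0; have As := closed_ereal_sup cA A0.
split; first exact: ereal_inf_lbound.
rewrite predeqE => y; split=> [Ay|/= [iy ys]]; last exact: cvA Ai As iy ys.
by split; [exact: ereal_inf_lbound|exact: ereal_sup_ubound].
Qed.

Lemma interval_itv x y : (x <= y)%E ->
  is_interval_value [set z | (x <= z)%E /\ (z <= y)%E].
Proof. by move=> xy; exists x, y. Qed.

Lemma interval_value_closed A : is_interval_value A -> closed A.
Proof.
move=> [a [b [_ ->]]]; rewrite (_ : mkset _ =
  [set z | (a <= z)%E] `&` [set z | (z <= b)%E]); last by rewrite predeqE.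
by apply: closedI; [exact: closed_ereal_le_ereal|exact: closed_ereal_ge_ereal].
Qed.

Lemma interval_nonempty A : is_interval_value A -> A !=set0.
Proof. by move=> [a [b [ab ->]]]; exists a; split. Qed.

Lemma interval_convex A x y z : is_interval_value A ->
  A x -> A z -> (x <= y)%E -> (y <= z)%E -> A y.
Proof.
move=> [a [b [ab ->]]] /= [ax xb] [az zb] xy yz.
by split; [exact: le_trans ax xy|exact: le_trans yz zb].
Qed.

Lemma intervalI A B : is_interval_value A -> is_interval_value B ->
  A `&` B !=set0 -> is_interval_value (A `&` B).
Proof.
move=> iA iB AB0; apply: closed_convex_interval => //.
- by apply: closedI; exact: interval_value_closed.
- move=> x y z [Ax Bx] [Az Bz] xy yz.
  by split; [exact: interval_convex Ax Az xy yz|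
             exact: interval_convex Bx Bz xy yz].
Qed.

Lemma interval_bigcap (I : Type) (D : set I) (F : I -> set (\bar R)) :
  (forall i, D i -> is_interval_value (F i)) ->
  \bigcap_(i in D) F i !=set0 -> is_interval_value (\bigcap_(i in D) F i).
Proof.
move=> iF F0; apply: closed_convex_interval => //.
- by apply: closed_bigI => i /iF/interval_value_closed.
- move=> x y z Fx Fz xy yz i Di.
  exact: interval_convex (iF i Di) (Fx i Di) (Fz i Di) xy yz.
Qed.

(** The closed set [C] is the other half of the line, overlapping [K] in one
    point.  Since [C] is compact, avoiding [C] is an open condition on the
    values of an S-continuous function, whence [S_continuous_separation]. *)
Lemma interval_separation A y : is_interval_value A -> ~ A y ->
  exists K C, [/\ is_interval_value K, closed C, A `&` C = set0, ~` C `<=` K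
    & ~ K y].
Proof.
move=> [a [b [ab ->]]] /not_andP[/negP|/negP]; rewrite -ltNge.
- move=> /ereal_dense [s ys sa].
  exists [set z | (s <= z)%E /\ (z <= +oo)%E], [set z | (z <= s)%E]; split.
  + by apply: interval_itv; rewrite leey.
  + exact: closed_ereal_ge_ereal.
  + rewrite -subset0 => z /= [[az _] zs].
    by have := lt_le_trans sa (le_trans az zs); rewrite ltxx.
  + by move=> z /= /negP; rewrite -ltNge => /ltW ?; rewrite leey.
  + by move=> /= [+ _]; rewrite leNgt ys.
- move=> /ereal_dense [s bs sy].
  exists [set z | (-oo <= z)%E /\ (z <= s)%E], [set z | (s <= z)%E]; split.
  + by apply: interval_itv; rewrite leNye.
  + exact: closed_ereal_le_ereal.
  + rewrite -subset0 => z /= [[_ zb] sz].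
    by have := lt_le_trans bs (le_trans sz zb); rewrite ltxx.
  + by move=> z /= /negP; rewrite -ltNge => /ltW ?; rewrite leNye.
  + by move=> /= [_]; rewrite leNgt sy.
Qed.

Definition itv_around (c e : R) : set (\bar R) :=
  [set y | ((c - e)%:E <= y)%E /\ (y <= (c + e)%:E)%E].

Lemma itv_aroundP c e : 0 <= e -> is_interval_value (itv_around c e).
Proof.
by move=> e0; apply: interval_itv; rewrite lee_fin lerBlDr -addrA lerDl addr_ge0.
Qed.

Lemma itv_around_fin c e r : itv_around c e r%:E <-> `|r - c| <= e.
Proof.
by rewrite /itv_around /= !lee_fin ler_distl; split=> [[-> ->]|/andP[]].
Qed.

Lemma itv_around_finite c e y : itv_around c e y -> y = (fine y)%:E.
Proof. by move: y => [y||] // [] /=. Qed.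

(** For an interval [K] with ends [u] and [v] this is the interval from
    [u - e] to [v + e]; infinite ends stay where they are. *)
Definition enlarge (K : set (\bar R)) (e : R) : set (\bar R) :=
  [set y | exists a b, [/\ K a, K b, (a - e%:E <= y)%E & (y <= b + e%:E)%E]].

Lemma enlarge_interval K e : is_interval_value K -> 0 <= e ->
  is_interval_value (enlarge K e).
Proof.
move=> [a [b [ab ->]]] e0; exists (a - e%:E)%E, (b + e%:E)%E; split.
  apply: (@le_trans _ _ a); first by rewrite leeBlDr// leeDl.
  by apply: le_trans ab _; rewrite leeDl.
rewrite predeqE => y; split=> [/= [a' [b' [[aa' _] [_ bb'] ay yb]]]|[ay yb]].
- split; first by apply: (le_trans _ ay); rewrite leeD2r.
  by apply: le_trans yb _; rewrite leeD.
- by exists a, b; split.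
Qed.

Lemma enlarge_limit K y : is_interval_value K ->
  (forall e, 0 < e -> enlarge K e y) -> K y.
Proof.
move=> [a [b [ab ->]]] Ky; split.
- apply/lee_addgt0Pr => e /Ky [a' [_ [[aa' _] _ ay _]]].
  by rewrite -leeBlDr//; apply: (le_trans _ ay); rewrite leeD2r.
- apply/lee_addgt0Pr => e /Ky [_ [b' [_ [_ bb'] _ yb]]].
  by apply: le_trans yb _; rewrite leeD.
Qed.

(** How a value of an envelope constrains the underlying real function: if
    [y] is at distance at most [e] from [c], then [c] is at distance at most
    [e] from each interval containing [y]. *)
Lemma enlarge_around K e c y : is_interval_value K -> K y -> itv_around c e y ->
  enlarge K e c%:E.
Proof.
move=> iK Ky yc; exists y, y; split => //; move: yc Ky.
- move=> /[dup] /itv_around_finite -> /itv_around_fin.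
  by rewrite ler_distl => /andP[? ?] _; rewrite -EFinB lee_fin lerBlDr.
- move=> /[dup] /itv_around_finite -> /itv_around_fin.
  by rewrite ler_distl => /andP[? ?] _; rewrite -EFinD lee_fin -lerBlDr.
Qed.

End ExtendedReals.

(** * S-continuity and H-continuity *)
Section IntervalFunctions.
Context {R : realType} {X : topologicalType}.
Implicit Types (f g h phi : X -> set (\bar R)) (K C : set (\bar R)) (V : set X).

(** Closed graph implies upper semicontinuity because the extended line is
    compact: this is the tube lemma applied to [C]. *)
Lemma S_continuous_avoid f x C : S_continuous f -> closed C ->
  f x `&` C = set0 -> \forall z \near x, f z `&` C = set0.
Proof.
move=> [_ cf] /closed_ereal_compact/compact_near_coveringP cC fC.
have {}cC := cC X (nbhs x) (fun z y => ~ f z y) _.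
apply: (filterS _ (cC _ _)) => [z /= fz|y Cy].
  by rewrite -subset0 => y [fzy /fz]; exact.
have : nbhs (x, y) (~` [set p : X * \bar R | f p.1 p.2]).
  apply: open_nbhs_nbhs; split; first exact: closed_openC.
  by move=> /= fxy; suff : set0 y by []; rewrite -fC.
move=> [[U W] /= [Ux Wy] UW]; exists (W, U) => //= -[y' x'] /= [Wy' Ux'].
exact: (UW (x', y')).
Qed.

Lemma S_continuous_separation f x y : S_continuous f -> ~ f x y ->
  exists K, [/\ is_interval_value K, ~ K y & \forall z \near x, f z `<=` K].
Proof.
move=> Sf nfxy.
have [K [C [iK cC fC CK nKy]]] := interval_separation (Sf.1 x) nfxy.
exists K; split=> //; apply: (filterS _ (S_continuous_avoid Sf cC fC)) => z fzC y' fy'.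
by apply: CK => Cy'; suff : set0 y' by []; rewrite -fzC.
Qed.

Lemma S_continuous_closed_meet f C : S_continuous f -> closed C ->
  closed [set x | f x `&` C !=set0].
Proof.
move=> Sf cC; rewrite -openC openE => x /= /set0P/negP/negPn/eqP fC.
apply: (filterS _ (S_continuous_avoid Sf cC fC)) => z /= fz.
by rewrite fz => -[].
Qed.

(** Cutting [f] down to [K] above the open set [V] removes from its graph the
    intersection of the graph with an open set, so the result is S-continuous
    and minimality applies. *)
Lemma H_continuous_cut f K V : H_continuous f -> is_interval_value K ->
  open V -> (forall z, V z -> f z `&` K !=set0) ->
  forall z, V z -> f z `<=` K.
Proof.
move=> [Sf minf] iK oV fK z Vz y fzy.
pose phi x := [set y | f x y /\ (V x -> K y)].
have phif : fun_incl phi f by move=> x ? [].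
suff phiE : phi = f by move: fzy; rewrite -phiE => -[_]; exact.
apply: minf => //; split.
- move=> x; have [Vx|nVx] := pselect (V x).
  + rewrite (_ : phi x = f x `&` K); last first.
      by rewrite predeqE => u; split => -[fu Ku]; split => //; exact: Ku.
    by apply: intervalI => //; [exact: Sf.1|exact: fK].
  + rewrite (_ : phi x = f x); first exact: Sf.1.
    by rewrite predeqE => ?; split => [[]|?].
- rewrite (_ : mkset _ = [set p : X * \bar R | f p.1 p.2] `&`
     ~` ((@fst X (\bar R)) @^-1` V `&` (@snd X (\bar R)) @^-1` (~` K))); last first.
    rewrite predeqE => -[x u]; split => /= [[fxu VK]|[fxu VK]]; split => //.
      by move=> [/VK Ku]; exact.
    by move=> Vx; apply: contrapT => nKu; apply: VK.
  apply: closedI; first exact: Sf.2.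
  apply: open_closedC; apply: openI.
  + by apply: open_comp => // ? _; exact: cvg_fst.
  + apply: open_comp; first by move=> ? _; exact: cvg_snd.
    by apply: closed_openC; exact: interval_value_closed.
Qed.

(** The converse of [H_continuous_cut]: if [y] in [f x] were not in [phi x],
    an interval containing [phi] near [x] but not [y] would meet all nearby
    values of [f], thus contain [f x]. *)
Lemma cut_H_continuous f : S_continuous f ->
  (forall K V, is_interval_value K -> open V ->
    (forall z, V z -> f z `&` K !=set0) -> forall z, V z -> f z `<=` K) ->
  H_continuous f.
Proof.
move=> Sf cutf; split => // phi Sphi phif; apply/funext => x.
rewrite predeqE => y; split=> [/phif//|fxy]; apply: contrapT => nphi.
have [K [iK nKy phiK]] := S_continuous_separation Sphi nphi.
apply: nKy.
have : nbhs x [set z | phi z `<=` K] := phiK.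
rewrite nbhsE => -[V [oV Vx] VK].
apply: (cutf K V) fxy => // z Vz.
have [u phiu] := interval_nonempty (Sphi.1 z).
by exists u; split; [exact: phif|exact: VK phiu].
Qed.

Lemma closed_infinite_points f : S_continuous f -> closed (infinite_points f).
Proof.
move=> Sf; rewrite (_ : infinite_points f = [set x | f x `&` [set -oo%E] !=set0]
    `|` [set x | f x `&` [set +oo%E] !=set0]).
  by apply: closedU; apply: S_continuous_closed_meet => //;
    exact: accessible_closed_set1 (hausdorff_accessible (@ereal_hausdorff R)) _.
rewrite predeqE => x; split=> [[fx|fx]|[[y [/[swap] ->]]|[y [/[swap] ->]]]].
- by left; exists -oo%E.
- by right; exists +oo%E.
- by left.
- by right.
Qed.

End IntervalFunctions.

(** * Generic properties *)
Section Generic.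
Context {X : topologicalType}.
Implicit Types (P Q O V W : set X).

Definition generic P : Prop := dense (interior P).

(** The form in which genericity is used in density arguments: it can be
    checked after shrinking any given nonempty open set. *)
Lemma genericP P : generic P <->
  forall O, open O -> O !=set0 -> exists W, [/\ open W, W !=set0, W `<=` O & W `<=` P].
Proof.
split=> [dP O oO O0|hP O O0 oO].
- exists (O `&` interior P); split.
  + by apply: openI => //; exact: open_interior.
  + exact: dP.
  + by move=> ? [].
  + by move=> ? [_]; exact: interior_subset.
- have [W [oW [w Ww] WO WP]] := hP O oO O0.
  exists w; split; first exact: WO.
  by apply: (filterS WP); exact: open_nbhs_nbhs.
Qed.

#[global] Instance generic_filter : Filter generic.
Proof.
split.
- by rewrite /generic interiorT => O [x Ox] _; exists x.
- move=> P Q gP gQ; rewrite /generic interiorI.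
  by apply: denseI => //; exact: open_interior.
- move=> P Q PQ gP O O0 oO; have [x [Ox Px]] := gP O O0 oO.
  by exists x; split => //; exact: interiorS Px.
Qed.

Lemma generic_meet P O : generic P -> open O -> O !=set0 -> P `&` O !=set0.
Proof.
move=> gP oO O0; have [x [Ox Px]] := gP O O0 oO.
by exists x; split => //; exact: interior_subset.
Qed.

(** The filter generated by the neighbourhoods of [x] and the dense open
    sets.  It is proper although [x] itself may lie outside its members. *)
Definition generic_at (x : X) : set_system X :=
  [set P | exists2 V, nbhs x V & generic [set z | V z -> P z]].

#[global] Instance generic_at_filter x : ProperFilter (generic_at x).
Proof.
apply: Build_ProperFilter_ex.
  move=> P [V]; rewrite nbhsE => -[U [oU Ux] UV] gP.
  have [z [Pz Uz]] := generic_meet gP oU (ex_intro _ x Ux).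
  by exists z; apply: Pz; exact: UV.
split.
- by exists setT; [exact: filterT|apply: filterE => z].
- move=> P Q [V xV gP] [W xW gQ]; exists (V `&` W); first exact: filterI.
  apply: (filterS2 _ _ gP gQ) => z /= VP WQ [Vz Wz].
  by split; [exact: VP|exact: WQ].
- move=> P Q PQ [V xV gP]; exists V => //.
  by apply: (filterS _ gP) => z /= VP /VP/PQ.
Qed.

Lemma generic_at_nbhs x P : nbhs x P -> generic_at x P.
Proof. by move=> xP; exists P => //; apply: filterE => z. Qed.

Lemma generic_at_generic x P : generic P -> generic_at x P.
Proof.
move=> gP; exists setT; first exact: filterT.
by apply: (filterS _ gP) => z Pz _.
Qed.

Lemma generic_at_near x P : generic_at x P -> \forall z \near x, generic_at z P.
Proof.
move=> [V xV gP]; apply: (filterS _ (nbhs_interior xV)) => z Vz; exists V => //.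
Qed.

End Generic.

(** * Generically continuous and generically null real functions *)
Section GenericFunctions.
Context {R : realType} {X : topologicalType}.
Implicit Types (c d : X -> R) (O V W : set X) (e : R).

(** This does not require [c] to be continuous at a single point: on a space
    that is not Baire the dense open sets for varying [e] may have empty
    intersection. *)
Definition gcont c : Prop := forall e, 0 < e ->
  generic [set x | \forall z \near x, `|c z - c x| < e].

Definition gnull c : Prop := forall e, 0 < e -> generic [set x | `|c x| < e].

(** Small oscillation on a neighbourhood of a generic point, freed from the
    choice of the point. *)
Lemma gcontP c : gcont c <-> forall e, 0 < e ->
  forall O, open O -> O !=set0 -> exists W, [/\ open W, W !=set0, W `<=` O
    & forall z w, W z -> W w -> `|c z - c w| < e].
Proof.
split=> [gc e e0 O oO O0|hc e e0].
- have e20 : 0 < e / 2 by rewrite divr_gt0.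
  have [x [xc Ox]] := generic_meet (gc _ e20) oO O0.
  have : nbhs x ([set z | `|c z - c x| < e / 2] `&` O).
    by apply: filterI; [exact: xc|exact: open_nbhs_nbhs].
  rewrite nbhsE => -[W [oW Wx] WO]; exists W; split => //; first by exists x.
    by move=> z /WO[].
  move=> z w /WO[/= zx _] /WO[/= wx _].
  rewrite -(subrK (c x) (c z)) -addrA (splitr e).
  by rewrite (le_lt_trans (ler_normD _ _))// ltrD// distrC.
- apply/genericP => O oO O0; have [W [oW W0 WO Wc]] := hc e e0 O oO O0.
  exists W; split => // x Wx.
  by apply: (filterS _ (open_nbhs_nbhs (conj oW Wx))) => z Wz; exact: Wc.
Qed.

Lemma gnullP c : gnull c <-> forall e, 0 < e ->
  forall O, open O -> O !=set0 -> exists W, [/\ open W, W !=set0, W `<=` O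
    & forall z, W z -> `|c z| < e].
Proof.
by split=> hc e e0; [apply/genericP; exact: hc|apply/genericP; exact: hc e e0].
Qed.

Lemma gnull0 : gnull 0.
Proof. by move=> e e0; apply: filterE => x; change (`|0 : R| < e); rewrite normr0. Qed.

Lemma gnullD c d : gnull c -> gnull d -> gnull (c + d).
Proof.
move=> gc gd e e0; have e20 : 0 < e / 2 by rewrite divr_gt0.
apply: (filterS2 _ _ (gc _ e20) (gd _ e20)) => x /= cx dx.
by rewrite (splitr e) (le_lt_trans (ler_normD _ _))// ltrD.
Qed.

Lemma gnullN c : gnull c -> gnull (- c).
Proof. by move=> gc e e0; apply: (filterS _ (gc e e0)) => x /=; rewrite normrN. Qed.

Lemma gnullB c d : gnull c -> gnull d -> gnull (c - d).
Proof. by move=> gc gd; exact/gnullD/gnullN. Qed.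

Lemma gcont_cst (k : R) : gcont (cst k).
Proof.
move=> e e0; apply: filterE => x; apply: filterE => z.
by rewrite /= subrr normr0.
Qed.

(** Products need local bounds.  A [gcont] function may be unbounded near a
    nowhere dense set, but every nonempty open set contains a smaller one
    where it is bounded. *)
Lemma gcont_bounded c O : gcont c -> open O -> O !=set0 ->
  exists W M, [/\ open W, W !=set0, W `<=` O, 0 < M & forall z, W z -> `|c z| <= M].
Proof.
move=> /gcontP/(_ 1 ltr01) gc oO O0; have [W [oW [x Wx] WO Wc]] := gc O oO O0.
exists W, (`|c x| + 1); split => //; first by exists x.
move=> z Wz; rewrite -(subrK (c x) (c z)) (le_trans (ler_normD _ _))//.
by rewrite addrC lerD2l ltW// Wc.
Qed.

Lemma gnullM c d : gcont c -> gnull d -> gnull (c * d).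
Proof.
move=> gc /gnullP gd; apply/gnullP => e e0 O oO O0.
have [V [M [oV V0 VO M0 VM]]] := gcont_bounded gc oO O0.
have [W [oW W0 WV Wd]] := gd (e / M) (divr_gt0 e0 M0) V oV V0.
exists W; split => // [z /WV/VO//|z Wz]; rewrite normrM.
rewrite (@le_lt_trans _ _ (M * `|d z|))//.
  by rewrite ler_wpM2r// VM//; exact: WV.
by rewrite mulrC -ltr_pdivlMr//; exact: Wd.
Qed.

Lemma gcontN c : gcont c -> gcont (- c).
Proof.
move=> gc e e0; apply: (filterS _ (gc e e0)) => x; apply: filterS => z.
by rewrite /= -opprD normrN.
Qed.

Lemma gcontD c d : gcont c -> gcont d -> gcont (c + d).
Proof.
move=> gc gd e e0; have e20 : 0 < e / 2 by rewrite divr_gt0.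
apply: (filterS2 _ _ (gc _ e20) (gd _ e20)) => x; apply: filterS2 => z /= cx dx.
rewrite [X in `|X|](_ : _ = (c z - c x) + (d z - d x)); last first.
  by change (c z + d z - (c x + d x) = (c z - c x) + (d z - d x)); ring.
by rewrite (splitr e) (le_lt_trans (ler_normD _ _))// ltrD.
Qed.

Lemma gcontM c d : gcont c -> gcont d -> gcont (c * d).
Proof.
move=> gc gd; apply/gcontP => e e0 O oO O0.
have [V [M [oV V0 VO M0 VM]]] := gcont_bounded gc oO O0.
have [V' [M' [oV' V'0 V'V M'0 V'M']]] := gcont_bounded gd oV V0.
have e1 : 0 < e / 2 / M' by rewrite !divr_gt0.
have e2 : 0 < e / 2 / M by rewrite !divr_gt0.
have /gcontP/(_ _ e1 _ oV' V'0) [W [oW W0 WV' Wc]] := gc.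
have /gcontP/(_ _ e2 _ oW W0) [W' [oW' W'0 W'W Wd]] := gd.
exists W'; split => // [z /W'W/WV'/V'V/VO//|z w zW wW].
rewrite [X in `|X|](_ : _ = c z * (d z - d w) + (c z - c w) * d w); last first.
  by change (c z * d z - c w * d w = c z * (d z - d w) + (c z - c w) * d w); ring.
rewrite (splitr e) (le_lt_trans (ler_normD _ _))// !normrM ltrD//.
- rewrite (@le_lt_trans _ _ (M * `|d z - d w|))//.
    by rewrite ler_wpM2r// VM//; exact/V'V/WV'/W'W.
  by rewrite mulrC -ltr_pdivlMr// Wd.
- rewrite (@le_lt_trans _ _ (`|c z - c w| * M'))//.
    by rewrite ler_wpM2l// V'M'//; exact/WV'/W'W.
  by rewrite -ltr_pdivlMr// Wc//; exact: W'W.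
Qed.

(** The property [gcont] only has to be tested on densely many open sets;
    this is what makes gluing possible. *)
Lemma gcont_piecewise c :
  (forall O, open O -> O !=set0 -> exists V d, [/\ open V, V !=set0, V `<=` O,
     gcont d & forall z, V z -> c z = d z]) ->
  gcont c.
Proof.
move=> hc; apply/gcontP => e e0 O oO O0.
have [V [d [oV V0 VO /gcontP gd cd]]] := hc O oO O0.
have [W [oW W0 WV Wd]] := gd e e0 V oV V0.
exists W; split => // [z /WV/VO//|z w Wz Ww].
by rewrite !cd ?Wd//; exact: WV.
Qed.

End GenericFunctions.

(** * Nearly finite H-continuous functions as classes of real functions *)
Section Envelope.
Context {R : realType} {X : topologicalType}.
Implicit Types (c d : X -> R) (O V W : set X) (e : R) (f g : X -> set (\bar R)).

Definition envelope c : X -> set (\bar R) := fun x =>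
  \bigcap_(K in [set K | is_interval_value K /\
                       generic_at x [set z | K (c z)%:E]]) K.

(** The values are nonempty by compactness: a cluster point of [c] along
    [generic_at x] lies in all the intervals.  The graph is closed because an
    interval that excludes [y] at [x] serves for all points near [x]. *)
Lemma envelope_S_continuous c : S_continuous (envelope c).
Proof.
split=> [x|].
- apply: interval_bigcap => [K []//|].
  pose F : set_system (\bar R) := (fun z => (c z)%:E) @ generic_at x.
  have [y [_ Fy]] : [set: \bar R] `&` cluster F !=set0.
    by apply: ereal_compact; exact: filterT.
  exists y => K [iK cK]; have /closure_id -> := interval_value_closed iK.
  by move=> B yB; exact: Fy.
- rewrite -openC openE => -[x y] /= /existsNP[K /not_implyP[[iK cK] nKy]].
  exists ([set z | generic_at z [set z | K (c z)%:E]], ~` K); first split => /=.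
  + exact: generic_at_near.
  + apply: open_nbhs_nbhs; split => //; apply: closed_openC.
    exact: interval_value_closed.
  + by move=> -[x' y'] /= [Kx' nKy'] /(_ K); apply: contra_not nKy'; apply.
Qed.

Lemma envelope_incl c f : S_continuous f -> generic [set x | f x (c x)%:E] ->
  fun_incl (envelope c) f.
Proof.
move=> Sf cf x y cy; apply: contrapT => nfy.
have [K [iK nKy fK]] := S_continuous_separation Sf nfy.
apply: nKy; apply: cy; split => //.
apply: (filterS2 _ _ (generic_at_nbhs fK) (generic_at_generic x cf)) => z /=.
by move=> fzK cz; exact: fzK.
Qed.

Lemma envelope_approx c K x : is_interval_value K ->
  (forall e, 0 < e -> generic_at x [set z | enlarge K e (c z)%:E]) ->
  envelope c x `<=` K.
Proof.
move=> iK cK y cy; apply: enlarge_limit => // e e0.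
by apply: cy; split; [apply: enlarge_interval => //; exact: ltW|exact: cK].
Qed.

Lemma envelope_near c e x : 0 < e -> (\forall z \near x, `|c z - c x| < e) ->
  envelope c x `<=` itv_around (c x) e.
Proof.
move=> e0 cx y cy; apply: cy; split; first exact/itv_aroundP/ltW.
by apply: generic_at_nbhs; apply: (filterS _ cx) => z /ltW/itv_around_fin.
Qed.

Lemma envelope_null_incl c d : gnull (c - d) -> fun_incl (envelope c) (envelope d).
Proof.
move=> cd x y cy K [iK dK]; apply: (@envelope_approx c _ x) cy => // e e0.
apply: (filterS2 _ _ dK (generic_at_generic x (cd e e0))) => z /= Kdz cdz.
apply: enlarge_around iK Kdz _; apply/itv_around_fin.
by rewrite distrC ltW.
Qed.

Lemma gnullC c d : gnull (c - d) -> gnull (d - c).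
Proof. by move=> /gnullN; rewrite opprB. Qed.

Lemma envelope_null c d : gnull (c - d) -> envelope c = envelope d.
Proof.
move=> cd; apply/funext => x; rewrite predeqE => y.
by split; [exact: envelope_null_incl|apply: envelope_null_incl; exact: gnullC].
Qed.

Lemma envelope_local c d x : (\forall z \near x, c z = d z) ->
  envelope c x = envelope d x.
Proof.
have sub c' d' : (\forall z \near x, c' z = d' z) ->
    envelope c' x `<=` envelope d' x.
  move=> cd y cy K [iK dK]; apply: cy; split => //.
  by apply: (filterS2 _ _ dK (generic_at_nbhs cd)) => z /= + ->.
move=> cd; rewrite predeqE => y; split; apply: sub => //.
by apply: (filterS _ cd).
Qed.

(** If the values of the envelope on [V] meet [K], then at a generic point of
    [V] the function [c] is within [e] of [K]; letting [e] tend to 0 puts the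
    envelope into [K], and [cut_H_continuous] concludes. *)
Lemma envelope_H_continuous c : gcont c -> H_continuous (envelope c).
Proof.
move=> gc; apply: cut_H_continuous; first exact: envelope_S_continuous.
move=> K V iK oV cK x Vx; apply: envelope_approx => // e e0.
exists V; first exact: open_nbhs_nbhs.
apply: (filterS _ (gc e e0)) => z cz Vz; have [y [cy Ky]] := cK z Vz.
by apply: enlarge_around iK Ky _; exact: (envelope_near e0 cz).
Qed.

Lemma nearly_finite_generic f : S_continuous f ->
  nearly_finite f <-> generic (~` infinite_points f).
Proof.
move=> /closed_infinite_points cf; rewrite /nearly_finite /nowhere_dense.
have -> : closure (infinite_points f) = infinite_points f.
  by rewrite -((closure_id _).1 cf).
split=> [[_ f0] O O0 oO|gf]; last first.
  split=> //; rewrite -subset0 => x fx.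
  have [y [nfy fy]] := generic_meet gf (open_interior (infinite_points f))
                         (ex_intro _ x fx).
  exact: nfy (interior_subset fy).
rewrite ((interior_id _).1 (closed_openC cf)); apply: contrapT => OF.
have [x Ox] := O0; suff : set0 x by []; rewrite -f0.
apply: (filterS _ (open_nbhs_nbhs (conj oO Ox))) => z Oz.
by apply: contrapT => nfz; apply: OF; exists z.
Qed.

Lemma envelope_Hnf c : gcont c -> Hnf R X (envelope c).
Proof.
move=> gc; split; first exact: envelope_H_continuous.
apply/nearly_finite_generic; first exact: envelope_S_continuous.
apply: (filterS _ (gc 1 ltr01)) => x /(envelope_near ltr01) cx.
by move=> [] /cx/itv_around_finite.
Qed.

(** A real selection of [f].  It is defined from the value [f x] alone, so
    two interval functions equal at [x] have the same [rep] at [x]; the gluing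
    of ring elements relies on this. *)
Definition rep f : X -> R := fun x => fine (xget 0%E (f x)).

Lemma rep_selection f : Hnf R X f -> generic [set x | f x (rep f x)%:E].
Proof.
move=> [[Sf _] /(nearly_finite_generic Sf) nf]; apply: (filterS _ nf) => x /= nfx.
rewrite /rep; case: xgetP => [y _ fy|f0].
- by case: y fy => [r||] //= fy; exfalso; apply: nfx; [right|left].
- by have [y fy] := interval_nonempty (Sf.1 x); have := f0 y.
Qed.

(** At a finite point of [f], let [r] be the lower end of the value.  Nearby
    values of [f] stay above [r - e / 3].  They cannot all meet the half-line
    above [r + e / 3], for by [H_continuous_cut] they would then lie inside
    it, contrary to the choice of [r].  So some nearby value lies within
    [e / 3] of [r], and so do all values close to it. *)
Lemma selection_gcont f c : Hnf R X f -> generic [set x | f x (c x)%:E] -> gcont c.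
Proof.
move=> [Hf nf] cf; have Sf := Hf.1; apply/gcontP => e e0 O oO O0.
have gf := (nearly_finite_generic Sf).1 nf.
have [x [nfx Ox]] := generic_meet gf oO O0.
have [a [b [ab fxE]]] := Sf.1 x.
have fxa : f x a by rewrite fxE; split.
have [r ar] : exists r, a = r%:E.
  case: a fxa {ab fxE} => [r||] fxa; first by exists r.
  - by exfalso; apply: nfx; right.
  - by exfalso; apply: nfx; left.
rewrite {a}ar in ab fxE fxa.
pose low : set (\bar R) := [set y | (y <= (r - e / 3)%:E)%E].
pose high : set (\bar R) := [set y | ((r + e / 3)%:E <= y)%E].
have : nbhs x ([set z | f z `&` low = set0] `&` O).
  apply: filterI; last exact: open_nbhs_nbhs.
  apply: S_continuous_avoid => //; first exact: closed_ereal_ge_ereal.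
  rewrite -subset0 => y [] /=; rewrite fxE => -[/= ry _] /(le_trans ry).
  by rewrite lee_fin; lra.
rewrite nbhsE => -[V [oV Vx] VO].
have [z Vz fz] : exists2 z, V z & f z `&` high = set0.
  apply: contrapT => nz; have : high r%:E.
    have -> : high = [set y | ((r + e / 3)%:E <= y)%E /\ (y <= +oo)%E].
      by rewrite predeqE => y; split => [?|[]//]; split => //; exact: leey.
    have iK := interval_itv (leey (r + e / 3)%:E).
    apply: (H_continuous_cut Hf iK oV _ Vx) => // z Vz.
    apply: contrapT => /set0P/negP/negPn/eqP fz; apply: nz; exists z => //.
    rewrite -fz predeqE => y; split=> [[fy hy]|[fy []]]; split => //.
    by split => //; exact: leey.
  by rewrite /high /= lee_fin; lra.
have : nbhs z ([set z | f z `&` high = set0] `&` V).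
  apply: filterI; last exact: open_nbhs_nbhs.
  by apply: S_continuous_avoid => //; exact: closed_ereal_le_ereal.
rewrite nbhsE => -[U [oU Uz] UV].
have [w [Uw cw]] : U `&` interior [set x | f x (c x)%:E] !=set0.
  by apply: cf => //; exists z.
exists (U `&` interior [set x | f x (c x)%:E]); split.
- by apply: openI => //; exact: open_interior.
- by exists w.
- by move=> ? [/UV[_ /VO[]]].
have cU w' : (U `&` interior [set x | f x (c x)%:E]) w' -> `|c w' - r| < e / 3.
  move=> [/UV[/= fh /VO[/= fl _]] /interior_subset/= fc].
  rewrite ltr_distl; apply/andP; split; rewrite ltNge; apply/negP => hc.
  + suff : set0 (c w')%:E by []; by rewrite -fl; split.
  + suff : set0 (c w')%:E by []; by rewrite -fh; split.
move=> p q /cU cp /cU cq.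
rewrite -(subrK r (c p)) -addrA (le_lt_trans (ler_normD _ _))//.
by rewrite [X in _ + X]distrC; lra.
Qed.

Lemma selection_envelope f c : H_continuous f -> generic [set x | f x (c x)%:E] ->
  envelope c = f.
Proof.
move=> [Sf minf] cf; apply: minf; first exact: envelope_S_continuous.
exact: envelope_incl.
Qed.

(** A selection of the envelope of [c] need not agree with [c] anywhere, but
    it is within any [e] of [c] generically. *)
Lemma envelope_selection c d : gcont c -> generic [set x | envelope c x (d x)%:E] ->
  gnull (d - c).
Proof.
move=> gc dc e e0; have e20 : 0 < e / 2 by rewrite divr_gt0.
apply: (filterS2 _ _ dc (gc _ e20)) => x /= dx cx.
have /itv_around_fin := envelope_near e20 cx dx.
by move=> /le_lt_trans; apply; rewrite ltr_pdivrMr// ltr_pMr// ltr1n.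
Qed.

Lemma gcont_rep f : Hnf R X f -> gcont (rep f).
Proof. by move=> Hf; exact: selection_gcont (rep_selection Hf). Qed.

Lemma rep_envelope c : gcont c -> gnull (rep (envelope c) - c).
Proof.
move=> gc; apply: envelope_selection => //.
exact/rep_selection/envelope_Hnf.
Qed.

Lemma envelope_rep f : Hnf R X f -> envelope (rep f) = f.
Proof.
by move=> Hf; apply: selection_envelope; [case: Hf|exact: rep_selection].
Qed.

Lemma envelope_eq_null c d : gcont c -> gcont d -> envelope c = envelope d ->
  gnull (c - d).
Proof.
move=> gc gd cd.
have -> : c - d = (rep (envelope d) - d) - (rep (envelope c) - c).
  by rewrite cd opprB [RHS]addrC subrKA.
by apply: gnullB; exact: rep_envelope.
Qed.

End Envelope.

(** * Pointwise operations on interval functions *)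
Section LiftedOperations.
Context {R : realType} {X : topologicalType}.
Implicit Types (f g h : X -> set (\bar R)) (a b y : \bar R).

Definition lift_op (op : \bar R -> \bar R -> set (\bar R)) f g : X -> set (\bar R) :=
  fun x => \bigcup_(a in f x) \bigcup_(b in g x) op a b.

Definition closed_op (op : \bar R -> \bar R -> set (\bar R)) : Prop :=
  closed [set p : (\bar R * \bar R) * \bar R | op p.1.1 p.1.2 p.2].

(** Intermediate values in the first argument, for a set-valued operation. *)
Definition darboux_op (op : \bar R -> \bar R -> set (\bar R)) : Prop :=
  forall (A : set (\bar R)) a a' b p y r, is_interval_value A -> A a -> A a' ->
    op a b p -> op a' b r -> (p <= y)%E -> (y <= r)%E ->
    exists2 a'', A a'' & op a'' b y.

(** The graph is the projection of a closed set along the compact square of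
    the extended line.  To join values at [(a, b)] and [(a', b')], move the
    first argument and then the second one, through a value [s] at
    [(a', b)]. *)
Lemma lift_S_continuous op f g : closed_op op -> darboux_op op ->
  (forall a b, op a b = op b a) -> (forall a b, op a b !=set0) ->
  S_continuous f -> S_continuous g -> S_continuous (lift_op op f g).
Proof.
move=> cop dop opC op0 Sf Sg.
have cl : closed [set p : X * \bar R | lift_op op f g p.1 p.2].
  rewrite -openC openE => -[x y] /= nxy.
  have /compact_near_coveringP cT : compact [set: \bar R * \bar R].
    by rewrite -setXTT; apply: compact_setX; exact: ereal_compact.
  have := cT _ (nbhs (x, y))
    (fun q p => ~ [/\ f q.1 p.1, g q.1 p.2 & op p.1 p.2 q.2]) _.
  move=> H.
  apply: (filterS _ (H _ _)) => [[x' y'] /= h [a fa [b gb oab]]|[a b] _].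
    exact: (h (a, b)).
  have avoid (S : topologicalType) (C : set S)
      (k : (\bar R * \bar R) * (X * \bar R) -> S) :
      closed C -> continuous k -> ~ C (k ((a, b), (x, y))) ->
      \forall p \near ((a, b), (x, y)), ~ C (k p).
    move=> cC ck nC; apply: (ck ((a, b), (x, y)) (~` C)).
    by apply: open_nbhs_nbhs; split => //; exact: closed_openC.
  have fst_c (S T : topologicalType) : continuous (@fst S T).
    by move=> ?; exact: cvg_fst.
  have snd_c (S T : topologicalType) : continuous (@snd S T).
    by move=> ?; exact: cvg_snd.
  have [fa|nfa] := pselect (f x a); last first.
    apply: (filterS _ (@avoid _ _ (fun p => (p.2.1, p.1.1)) Sf.2 _ nfa)).
      by move=> p /= + [].
    move=> p; apply: cvg_pair => /=.
      by apply: (@continuous_comp _ _ _ snd fst); [exact: snd_c|exact: fst_c].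
    by apply: (@continuous_comp _ _ _ fst fst); exact: fst_c.
  have [gb|ngb] := pselect (g x b); last first.
    apply: (filterS _ (@avoid _ _ (fun p => (p.2.1, p.1.2)) Sg.2 _ ngb)).
      by move=> p /= + [].
    move=> p; apply: cvg_pair => /=.
      by apply: (@continuous_comp _ _ _ snd fst); [exact: snd_c|exact: fst_c].
    by apply: (@continuous_comp _ _ _ fst snd); [exact: fst_c|exact: snd_c].
  have nop : ~ op a b y by move=> oab; apply: nxy; exists a => //; exists b.
  apply: (filterS _ (@avoid _ _ (fun p => (p.1, p.2.2)) cop _ nop)).
    by move=> p /= + [].
  move=> p; apply: (@cvg_pair _ _ _ (nbhs p) (nbhs p.1) (nbhs p.2.2)).
    exact: fst_c.
  by apply: (@continuous_comp _ _ _ snd snd); exact: snd_c.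
split => // x; apply: closed_convex_interval.
- have -> : lift_op op f g x = (fun y => (x, y)) @^-1`
      [set p : X * \bar R | lift_op op f g p.1 p.2] by [].
  apply: (closed_comp _ cl) => y _.
  apply: (@cvg_pair _ _ _ (nbhs y) (nbhs x) (nbhs y)); [exact: cvg_cst|exact: cvg_id].
- have [a fa] := interval_nonempty (Sf.1 x).
  have [b gb] := interval_nonempty (Sg.1 x).
  by have [y oy] := op0 a b; exists y; exists a => //; exists b.
- move=> p y r [a fa [b gb op_p]] [a' fa' [b' gb' op_r]] py yr.
  have [s os] := op0 a' b.
  have [ys|/ltW sy] := leP y s.
  + have [a'' fa'' oy] := dop _ _ _ _ _ _ _ (Sf.1 x) fa fa' op_p os py ys.
    by exists a'' => //; exists b.
  + rewrite opC in os; rewrite opC in op_r.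
    have [b'' gb'' oy] := dop _ _ _ _ _ _ _ (Sg.1 x) gb gb' os op_r sy yr.
    by exists a' => //; exists b'' => //; rewrite opC.
Qed.

(** Existence holds by [envelope_incl].  For uniqueness, a generic real
    selection of an H-continuous function inside the lifted operation is
    obtained by applying [ro] to selections [c] and [d] of [f] and [g].  These
    are [gcont] and differ from [rep f] and [rep g] by [gnull] functions. *)
Lemma Hcont_in_lift op (ro : R -> R -> R) f g :
  closed_op op -> darboux_op op ->
  (forall a b, op a b = op b a) -> (forall a b, op a b !=set0) ->
  (forall r s : R, op r%:E s%:E = [set (ro r s)%:E]) ->
  (forall c d : X -> R, gcont c -> gcont d -> gcont (fun x => ro (c x) (d x))) ->
  (forall c c' d d' : X -> R, gcont c -> gcont c' -> gcont d -> gcont d' ->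
    gnull (c - c') -> gnull (d - d') ->
    gnull ((fun x => ro (c x) (d x)) - (fun x => ro (c' x) (d' x)))) ->
  Hnf R X f -> Hnf R X g ->
  Hcont_in (lift_op op f g) = [set envelope (fun x => ro (rep f x) (rep g x))].
Proof.
move=> cop dop opC op0 op_real ro_gcont ro_null Hf Hg.
have [[Sf _] nf] := Hf; have [[Sg _] ng] := Hg.
have SF := lift_S_continuous cop dop opC op0 Sf Sg.
rewrite predeqE => h; split=> [[Hh hF]|->]; last first.
  split; first by apply: envelope_H_continuous; apply: ro_gcont; exact: gcont_rep.
  apply: envelope_incl => //.
  apply: (filterS2 _ _ (rep_selection Hf) (rep_selection Hg)) => x /= fx gx.
  by exists (rep f x)%:E => //; exists (rep g x)%:E => //; rewrite op_real.
have pick x : exists p : R * R, ~ infinite_points f x -> ~ infinite_points g x ->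
    [/\ f x p.1%:E, g x p.2%:E & h x (ro p.1 p.2)%:E].
  have [y hy] := interval_nonempty (Hh.1.1 x).
  have [a fa [b gb oab]] := hF _ _ hy.
  exists (fine a, fine b) => nfx ngx.
  have aE : a = (fine a)%:E.
    by case: a fa {oab} => [//||] fa; exfalso; apply: nfx; [right|left].
  have bE : b = (fine b)%:E.
    by case: b gb {oab} => [//||] gb; exfalso; apply: ngx; [right|left].
  rewrite aE bE in oab; rewrite -aE -bE; split => //=.
  by move: oab; rewrite op_real => <-.
have [s sP] := choice pick.
pose c x := (s x).1; pose d x := (s x).2.
have gf := (nearly_finite_generic Sf).1 nf.
have gg := (nearly_finite_generic Sg).1 ng.
have cf : generic [set x | f x (c x)%:E].
  by apply: (filterS2 _ _ gf gg) => x nfx ngx; have [] := sP x nfx ngx.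
have dg : generic [set x | g x (d x)%:E].
  by apply: (filterS2 _ _ gf gg) => x nfx ngx; have [] := sP x nfx ngx.
have cdh : generic [set x | h x (ro (c x) (d x))%:E].
  by apply: (filterS2 _ _ gf gg) => x nfx ngx; have [] := sP x nfx ngx.
have gc := selection_gcont Hf cf; have gd := selection_gcont Hg dg.
rewrite -(selection_envelope Hh cdh); apply: envelope_null; apply: ro_null => //.
- exact: gcont_rep.
- exact: gcont_rep.
- by apply: envelope_eq_null => //; [exact: gcont_rep|
    rewrite envelope_rep// (selection_envelope _ cf)//; case: Hf].
- by apply: envelope_eq_null => //; [exact: gcont_rep|
    rewrite envelope_rep// (selection_envelope _ dg)//; case: Hg].
Qed.

End LiftedOperations.

(** * Sums and products of extended reals *)
Section ExtendedArithmetic.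
Context {R : realType}.
Implicit Types (a b y : \bar R).

(** [amb] is the set of the ambiguous pairs, at which the operation takes all
    extended reals as values. *)
Lemma closed_op_continuous (amb : set (\bar R * \bar R)) (m : \bar R * \bar R -> \bar R)
    (op : \bar R -> \bar R -> set (\bar R)) :
  closed amb -> (forall p, ~ amb p -> {for p, continuous m}) ->
  (forall a b, amb (a, b) -> op a b = setT) ->
  (forall a b, ~ amb (a, b) -> op a b = [set m (a, b)]) ->
  closed_op op.
Proof.
move=> camb cm opT op1; rewrite /closed_op -openC openE => -[[a b] y] /= noy.
have nab : ~ amb (a, b) by move=> /opT oT; apply: noy; rewrite oT.
have my : y != m (a, b) by apply/eqP => ym; apply: noy; rewrite op1.
have := @ereal_hausdorff R; rewrite open_hausdorff => /(_ _ _ my).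
move=> [[B A] /= [yB mA] [oB oA /eqP BA]].
have H : nbhs (a, b) ([set p | ~ amb p] `&` m @^-1` A).
  apply: filterI; first by apply: open_nbhs_nbhs; split => //; exact: closed_openC.
  by apply: cm => //; apply: open_nbhs_nbhs; split => //; exact: set_mem.
exists ([set p | ~ amb p] `&` m @^-1` A, B).
  by split => //=; apply: open_nbhs_nbhs; split => //; exact: set_mem.
move=> [[a' b'] y'] /= [[nab' mA'] By'] oy; have : (B `&` A) y'.
  by split => //; move: oy; rewrite op1// => ->.
by rewrite BA.
Qed.

Lemma eadd_setC a b : eadd_set a b = eadd_set b a.
Proof.
by rewrite /eadd_set addeC orbC (andbC (a == +oo)%E) (andbC (a == -oo)%E).
Qed.

Lemma eadd_set_neq0 a b : eadd_set a b !=set0.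
Proof. by rewrite /eadd_set; case: ifP => _; [exists 0%E|exists (a + b)%E]. Qed.

Lemma eadd_set_real (r s : R) : eadd_set r%:E s%:E = [set (r + s)%:E].
Proof. by []. Qed.

Lemma emul_setC a b : emul_set a b = emul_set b a.
Proof. by rewrite /emul_set orbC muleC. Qed.

Lemma emul_set_neq0 a b : emul_set a b !=set0.
Proof. by rewrite /emul_set; case: ifP => _; [exists 0%E|exists (a * b)%E]. Qed.

Lemma emul_set_real (r s : R) : emul_set r%:E s%:E = [set (r * s)%:E].
Proof. by rewrite /emul_set /= !andbF. Qed.

Lemma closed_ereal_pair a b : closed [set (a, b)].
Proof.
have cl1 (x : \bar R) : closed [set x].
  exact: accessible_closed_set1 (hausdorff_accessible (@ereal_hausdorff R)) _.
rewrite (_ : [set (a, b)] = fst @^-1` [set a] `&` snd @^-1` [set b]).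
  apply: closedI; apply: closed_comp => // p _; [exact: cvg_fst|exact: cvg_snd].
by rewrite predeqE => -[x y]; split => [[-> ->]|[/= -> ->]].
Qed.

Lemma eadd_set_closed : closed_op (@eadd_set R).
Proof.
apply: (@closed_op_continuous ([set (-oo, +oo)%E] `|` [set (+oo, -oo)%E])
  (fun p => (p.1 + p.2)%E)).
- by apply: closedU; exact: closed_ereal_pair.
- move=> [a b] /not_orP[/= h1 h2]; apply: cvgeD.
  + by case: a b h1 h2 => [a||] [b||] //=.
  + exact: cvg_fst.
  + exact: cvg_snd.
- by move=> a b [[-> ->]|[-> ->]]; rewrite /eadd_set.
- move=> a b /not_orP[/= h1 h2]; rewrite /eadd_set ifF//; apply/negP.
  by move=> /orP[] /andP[/eqP aE /eqP bE]; rewrite aE bE in h1 h2.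
Qed.

Lemma emul_set_closed : closed_op (@emul_set R).
Proof.
apply: (@closed_op_continuous (([set (0, +oo)%E] `|` [set (0, -oo)%E]) `|`
  ([set (+oo, 0)%E] `|` [set (-oo, 0)%E])) (fun p => (p.1 * p.2)%E)).
- by apply: closedU; apply: closedU; exact: closed_ereal_pair.
- move=> [a b] /not_orP[/not_orP[h1 h2] /not_orP[h3 h4]]; apply: cvgeM.
  + case: a b h1 h2 h3 h4 => [a||] [b||] //= h1 h2 h3 h4; rewrite /mule_def;
      apply/eqP => z0; [apply: h1|apply: h2|apply: h3|apply: h4]; by rewrite z0.
  + exact: cvg_fst.
  + exact: cvg_snd.
- by move=> a b [[[-> ->]|[-> ->]]|[[-> ->]|[-> ->]]]; rewrite /emul_set eqxx.
- move=> a b /not_orP[/not_orP[/= h1 h2] /not_orP[/= h3 h4]].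
  rewrite /emul_set ifF//; apply/negP.
  by move=> /orP[] /andP[/eqP aE /orP[]/eqP bE]; rewrite aE bE in h1 h2 h3 h4.
Qed.


Lemma eadd_set_darboux : darboux_op (@eadd_set R).
Proof.
move=> A a a' b p y r iA Aa Aa'; case: b => [s||].
- have addE x : eadd_set x s%:E = [set (x + s%:E)%E] by rewrite /eadd_set !andbF.
  rewrite !addE => -> -> py yr; exists (y - s%:E)%E.
    by apply: (interval_convex iA Aa Aa'); rewrite ?leeBrDr// leeBlDr.
  by rewrite addE; apply/esym/subeK.
- have [aN|aN] := eqVneq a (-oo)%E.
    by move=> _ _ _ _; exists a => //; rewrite aN /eadd_set.
  rewrite {1}/eadd_set (negbTE aN) /= andbF => -> _.
  rewrite addey// leye_eq => /eqP -> _; exists a => //.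
  by rewrite /eadd_set (negbTE aN) /= andbF /= addey.
- have [aN|aN] := eqVneq a' (+oo)%E.
    by move=> _ _ _ _; exists a' => //; rewrite aN /eadd_set.
  move=> _; rewrite {1}/eadd_set (negbTE aN) /= andbF => -> _.
  rewrite addeNy leeNy_eq => /eqP ->; exists a' => //.
  by rewrite /eadd_set (negbTE aN) /= andbF /= addeNy.
Qed.

Lemma emul_set0y (A : set (\bar R)) b y : (b == +oo)%E || (b == -oo)%E -> A 0%E ->
  exists2 a, A a & emul_set a b y.
Proof. by move=> b_oo A0; exists 0%E => //; rewrite /emul_set eqxx b_oo. Qed.

Lemma emul_set_neq0E a b : a != 0%E -> (b == +oo)%E || (b == -oo)%E ->
  emul_set a b = [set (a * b)%E].
Proof. by move=> a0; rewrite /emul_set (negbTE a0)/= => /orP[]/eqP ->. Qed.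

Lemma emul_set_fin0 a (s : R) : s != 0 -> emul_set a s%:E = [set (a * s%:E)%E].
Proof. by move=> s0; rewrite /emul_set /= eqe (negbTE s0) !andbF. Qed.

Lemma emul_set_darboux : darboux_op (@emul_set R).
Proof.
move=> A a a' b p y r iA Aa Aa'.
have infinite : (b == +oo)%E || (b == -oo)%E -> (0 < a)%E = (0 < a')%E ->
    a != 0%E -> a' != 0%E -> emul_set a b p -> emul_set a' b r ->
    (p <= y)%E -> (y <= r)%E -> exists2 a'', A a'' & emul_set a'' b y.
  move=> b_oo aa' a0 a'0; rewrite !emul_set_neq0E// => -> -> py yr.
  have ba : (a * b = a' * b)%E.
    have [a_gt0|a_lt0|/eqP] := ltgtP 0%E a; last by rewrite eq_sym (negbTE a0).
    - have a'_gt0 : (0 < a')%E by rewrite -aa'.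
      by case/orP: b_oo => /eqP ->; rewrite ?gt0_muley// ?gt0_muleNy.
    - have a'_lt0 : (a' < 0)%E.
        by rewrite lt_neqAle a'0 leNgt -aa' -leNgt ltW.
      by case/orP: b_oo => /eqP ->; rewrite ?lt0_muley// ?lt0_muleNy.
  exists a => //; rewrite emul_set_neq0E//=; apply/eqP.
  by rewrite eq_le [X in _ && X]py ba yr.
have [b_oo|] := boolP ((b == +oo)%E || (b == -oo)%E).
  have [a0|a0] := eqVneq a 0%E.
    by move=> *; apply: emul_set0y => //; rewrite -a0.
  have [a'0|a'0] := eqVneq a' 0%E.
    by move=> *; apply: emul_set0y => //; rewrite -a'0.
  have [aa'|aa'] := boolP ((0 < a)%E == (0 < a')%E).
    by apply: infinite => //; exact/eqP.
  (* a and a' have opposite signs, hence 0 lies in A *)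
  move=> *; apply: emul_set0y => //.
  have [a_gt0|a_lt0|/eqP] := ltgtP 0%E a; last by rewrite eq_sym (negbTE a0).
  - apply: (interval_convex iA Aa' Aa); last exact: ltW.
    by move: aa'; rewrite a_gt0 leNgt; apply: contraNN => ->.
  - apply: (interval_convex iA Aa Aa'); first exact: ltW.
    have a0F : (0 < a)%E = false by apply/negbTE; rewrite -leNgt ltW.
    by move: aa'; rewrite a0F eq_sym eqbF_neg negbK => /ltW.
case: b {infinite} => [s _||]; rewrite ?eqxx ?orbT //.
have [s0|s0] := eqVneq s 0; last first.
  rewrite !emul_set_fin0// => -> -> py yr; exists (y * s^-1%:E)%E; last first.
    by rewrite emul_set_fin0//= -muleA -EFinM mulVf// mule1.
  move: s0; rewrite neq_lt => /orP[s0|s0].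
  - by apply: (interval_convex iA Aa' Aa); rewrite ?lee_ndivlMr// lee_ndivrMr.
  - by apply: (interval_convex iA Aa Aa'); rewrite ?lee_pdivlMr// lee_pdivrMr.
rewrite s0; have [aoo|aoo] := boolP ((a == +oo)%E || (a == -oo)%E).
  by move=> *; exists a => //; rewrite /emul_set eqxx /= aoo orbT.
have [a'oo|a'oo] := boolP ((a' == +oo)%E || (a' == -oo)%E).
  by move=> *; exists a' => //; rewrite /emul_set eqxx /= a'oo orbT.
rewrite /emul_set !eqxx (negbTE aoo) (negbTE a'oo) /= !andbF !mule0 => -> -> y0 y0'.
exists a => //; rewrite (negbTE aoo) /= andbF mule0.
by change (y = 0%E); apply/le_anti/andP; split.
Qed.

End ExtendedArithmetic.

(** * The ring of nearly finite H-continuous functions *)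
Section HnfType.
Context {R : realType} {X : topologicalType}.

Record hnf := MkHnf { hval : X -> set (\bar R); hvalP : Hnf R X hval }.

HB.instance Definition _ := gen_eqMixin hnf.
HB.instance Definition _ := gen_choiceMixin hnf.

Implicit Types (a b : hnf) (c d : X -> R).

Lemma hval_inj : injective hval.
Proof.
move=> [f Hf] [g Hg] /= fg; subst g; congr MkHnf; exact: Prop_irrelevance.
Qed.

Definition hnf_of c (gc : gcont c) : hnf := MkHnf (envelope_Hnf gc).

Definition hrep a : X -> R := rep (hval a).

Lemma gcont_hrep a : gcont (hrep a). Proof. exact/gcont_rep/hvalP. Qed.

(** Every element is the class of a [gcont] function; with [hadd_of] and
    [hmul_of] this reduces the ring axioms to those of real functions. *)
Lemma hnf_ind (P : hnf -> Prop) : (forall c (gc : gcont c), P (hnf_of gc)) ->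
  forall a, P a.
Proof.
move=> Pc a; have -> : a = hnf_of (gcont_hrep a); last exact: Pc.
by apply: hval_inj; rewrite /= envelope_rep//; exact: hvalP.
Qed.

Lemma hnf_of_eq c d (gc : gcont c) (gd : gcont d) :
  gnull (c - d) <-> hnf_of gc = hnf_of gd.
Proof.
split=> [cd|/(congr1 hval)/=]; first by apply: hval_inj; exact: envelope_null.
exact: envelope_eq_null.
Qed.

Lemma hnf_of_ext c d (gc : gcont c) (gd : gcont d) : c = d -> hnf_of gc = hnf_of gd.
Proof. by move=> cd; apply/hnf_of_eq; rewrite cd subrr; exact: gnull0. Qed.

Lemma hrep_null c (gc : gcont c) : gnull (hrep (hnf_of gc) - c).
Proof. exact: rep_envelope. Qed.

Definition hzero := hnf_of (gcont_cst 0).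
Definition hone := hnf_of (gcont_cst 1).
Definition hopp a := hnf_of (gcontN (gcont_hrep a)).
Definition hadd a b := hnf_of (gcontD (gcont_hrep a) (gcont_hrep b)).
Definition hmul a b := hnf_of (gcontM (gcont_hrep a) (gcont_hrep b)).

Lemma gnullD_congr c c' d d' : gnull (c - c') -> gnull (d - d') ->
  gnull ((c + d) - (c' + d')).
Proof. by move=> cc' dd'; rewrite opprD addrACA; exact: gnullD. Qed.

Lemma gnullM_congr c c' d d' : gcont c -> gcont c' -> gcont d -> gcont d' ->
  gnull (c - c') -> gnull (d - d') -> gnull (c * d - c' * d').
Proof.
move=> gc gc' gd gd' cc' dd'.
have -> : c * d - c' * d' = c * (d - d') + d' * (c - c').
  by rewrite !mulrBr addrA (mulrC d' c) subrK (mulrC c').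
by apply: gnullD; exact: gnullM.
Qed.

Lemma hopp_of c (gc : gcont c) : hopp (hnf_of gc) = hnf_of (gcontN gc).
Proof. by apply/hnf_of_eq; rewrite -opprD; exact/gnullN/hrep_null. Qed.

Lemma hadd_of c d (gc : gcont c) (gd : gcont d) :
  hadd (hnf_of gc) (hnf_of gd) = hnf_of (gcontD gc gd).
Proof. by apply/hnf_of_eq/gnullD_congr; exact: hrep_null. Qed.

Lemma hmul_of c d (gc : gcont c) (gd : gcont d) :
  hmul (hnf_of gc) (hnf_of gd) = hnf_of (gcontM gc gd).
Proof.
by apply/hnf_of_eq; apply: gnullM_congr => //;
  (exact: gcont_hrep || exact: hrep_null).
Qed.

Lemma haddA : associative hadd.
Proof.
elim/hnf_ind => c gc; elim/hnf_ind => d gd; elim/hnf_ind => e ge.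
by rewrite !hadd_of; apply: hnf_of_ext; rewrite addrA.
Qed.

Lemma haddC : commutative hadd.
Proof.
elim/hnf_ind => c gc; elim/hnf_ind => d gd.
by rewrite !hadd_of; apply: hnf_of_ext; rewrite addrC.
Qed.

Lemma hadd0 : left_id hzero hadd.
Proof.
by elim/hnf_ind => c gc; rewrite hadd_of; apply: hnf_of_ext; exact: add0r.
Qed.

Lemma haddN : left_inverse hzero hopp hadd.
Proof.
elim/hnf_ind => c gc; rewrite hopp_of hadd_of; apply: hnf_of_ext.
exact: addNr.
Qed.

HB.instance Definition _ := GRing.isZmodule.Build hnf haddA haddC hadd0 haddN.

Lemma hmulA : associative hmul.
Proof.
elim/hnf_ind => c gc; elim/hnf_ind => d gd; elim/hnf_ind => e ge.
by rewrite !hmul_of; apply: hnf_of_ext; rewrite mulrA.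
Qed.

Lemma hmulC : commutative hmul.
Proof.
elim/hnf_ind => c gc; elim/hnf_ind => d gd.
by rewrite !hmul_of; apply: hnf_of_ext; rewrite mulrC.
Qed.

Lemma hmul1 : left_id hone hmul.
Proof.
by elim/hnf_ind => c gc; rewrite hmul_of; apply: hnf_of_ext; exact: mul1r.
Qed.

Lemma hmulDl : left_distributive hmul hadd.
Proof.
elim/hnf_ind => c gc; elim/hnf_ind => d gd; elim/hnf_ind => e ge.
by rewrite !(hadd_of, hmul_of); apply: hnf_of_ext; rewrite mulrDl.
Qed.

HB.instance Definition _ :=
  GRing.Zmodule_isComPzRing.Build hnf hmulA hmulC hmul1 hmulDl.

Lemma envelope_cst (k : R) : envelope (cst k : X -> R) = fun=> [set k%:E].
Proof.
apply/funext => x.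
have sub : envelope (cst k : X -> R) x `<=` [set k%:E].
  move=> y /(_ [set z | (k%:E <= z)%E /\ (z <= k%:E)%E]) [].
    split; first exact: interval_itv.
    by apply: filterE => z /=; rewrite lexx.
  by move=> ky yk; apply/le_anti/andP.
have [y ey] := interval_nonempty ((envelope_S_continuous (cst k : X -> R)).1 x).
rewrite predeqE => z; split=> [/sub //|->].
by rewrite -(sub _ ey).
Qed.

Lemma hval_is_Hnf_ring : is_Hnf_ring (hval : hnf -> _).
Proof.
split.
- split=> [a _|a b _ _|f Hf]; first exact: hvalP.
  + exact: hval_inj.
  + by exists (MkHnf Hf).
- exact: envelope_cst.
- exact: envelope_cst.
- move=> a b; apply: (@Hcont_in_lift _ _ (@eadd_set R) +%R).
  + exact: eadd_set_closed.
  + exact: eadd_set_darboux.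
  + exact: eadd_setC.
  + exact: eadd_set_neq0.
  + exact: eadd_set_real.
  + by move=> c d; exact: gcontD.
  + by move=> c c' d d' _ _ _ _; exact: gnullD_congr.
  + exact: hvalP.
  + exact: hvalP.
- move=> a b; apply: (@Hcont_in_lift _ _ (@emul_set R) *%R).
  + exact: emul_set_closed.
  + exact: emul_set_darboux.
  + exact: emul_setC.
  + exact: emul_set_neq0.
  + exact: emul_set_real.
  + by move=> c d; exact: gcontM.
  + by move=> c c' d d'; exact: gnullM_congr.
  + exact: hvalP.
  + exact: hvalP.
Qed.

Lemma mulrE_of c d (gc : gcont c) (gd : gcont d) :
  hnf_of gc * hnf_of gd = hnf_of (gcontM gc gd).
Proof. exact: hmul_of. Qed.

End HnfType.

(** * Regularity, gluing and rational completeness *)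
Section RationalCompleteness.
Context {R : realType} {X : topologicalType}.
Implicit Types (c d : X -> R) (O U V : set X).

(** The only points near which the characteristic function varies are those
    of the boundary of [O], which is nowhere dense. *)
Lemma gcont_indic O : open O -> gcont (\1_O : X -> R).
Proof.
move=> oO; apply: gcont_piecewise => V oV V0.
have [[x [Ox Vx]]|OV] := pselect (O `&` V !=set0).
- exists (O `&` V), (cst 1); split; [exact: openI|by exists x|by move=> ? []| |].
    exact: gcont_cst.
  by move=> z [Oz _]; rewrite indicE mem_set.
- exists V, (cst 0); split => //; first exact: gcont_cst.
  by move=> z Vz; rewrite indicE memNset// => Oz; apply: OV; exists z.
Qed.

Definition hindic O (oO : open O) : @hnf R X := hnf_of (gcont_indic oO).

Lemma indicM O V : (\1_O * \1_V : X -> R) = \1_(O `&` V).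
Proof. by rewrite indicI. Qed.

Lemma hindic_idem O (oO : open O) : hindic oO * hindic oO = hindic oO.
Proof. by rewrite mulrE_of; apply: hnf_of_ext; rewrite indicM setIid. Qed.

Lemma hindic_disjoint O V (oO : open O) (oV : open V) : O `&` V = set0 ->
  hindic oO * hindic oV = 0.
Proof.
move=> OV; rewrite mulrE_of; apply: hnf_of_ext.
by rewrite indicM OV; apply/funext => x; rewrite indicE in_set0.
Qed.

Lemma hindic_eq0 O (oO : open O) : hindic oO = 0 -> O = set0.
Proof.
move=> /hnf_of_eq/(_ 1 ltr01) gO; rewrite -subset0 => x Ox.
have [z [zO Oz]] := generic_meet gO oO (ex_intro _ x Ox); move: zO => /=.
change (`|\1_O z - 0 : R| < 1 -> False).
by rewrite indicE mem_set// subr0 normr1 ltxx.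
Qed.

(** Equality in the ring after restriction to [O] is equality of the interval
    functions at every point of [O], not only generically. *)
Lemma hval_local (a b : @hnf R X) O (oO : open O) : a * hindic oO = b * hindic oO ->
  forall x, O x -> hval a x = hval b x.
Proof.
have loc (d : @hnf R X) x : O x -> hval (d * hindic oO) x = hval d x.
  elim/(@hnf_ind R X): d => d gd Ox; rewrite mulrE_of /=; apply: envelope_local.
  apply: (filterS _ (open_nbhs_nbhs (conj oO Ox))) => z Oz.
  by change (d z * \1_O z = d z); rewrite indicE mem_set// mulr1.
by move=> ab x Ox; rewrite -(loc a)// ab loc.
Qed.

(** [U] is the set of the points near which [c] is bounded away from 0, and
    [c'] is [1 / c] on [U] and 0 elsewhere.  Outside the closure of [U] the
    function [c] is [gnull]: where its oscillation is small, it takes small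
    values. *)
Lemma gcont_quasi_inverse c : gcont c -> exists U c',
  [/\ open U, gcont c', c * c' = \1_U & gnull (c * \1_U - c)].
Proof.
move=> gc.
pose U := [set x : X | exists2 e : R, 0 < e & \forall z \near x, e <= `|c z|].
have oU : open U.
  rewrite openE => x [e e0 ce].
  by apply: (filterS _ (nbhs_interior ce)) => z ze; exists e.
pose c' (x : X) : R := \1_U x * (c x)^-1.
exists U, c'; split => //.
- apply/gcontP => e e0 O oO O0.
  have [[x [[e1 e10 xe1] Ox]]|UO] := pselect (U `&` O !=set0); last first.
    exists O; split => // z w Oz Ow.
    have nU y : O y -> y \notin U.
      by move=> Oy; apply/negP => /set_mem Uy; apply: UO; exists y.
    by rewrite /c' !indicE !(negbTE (nU _ _))// !mul0r subrr normr0.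
  have : nbhs x ([set z | e1 <= `|c z|] `&` (U `&` O)).
    apply: filterI; first exact: xe1.
    apply: open_nbhs_nbhs; split; first exact: openI.
    by split => //; exists e1.
  rewrite nbhsE => -[V [oV Vx] VO].
  have ee0 : 0 < e * e1 * e1 by rewrite !mulr_gt0.
  have /gcontP/(_ _ ee0 V oV (ex_intro _ x Vx)) [W [oW W0 WV Wc]] := gc.
  exists W; split => // [z /WV/VO[_ []]//|z w Wz Ww].
  have [/= cz [Uz _]] := VO _ (WV _ Wz); have [/= cw [Uw _]] := VO _ (WV _ Ww).
  have cz0 : 0 < `|c z| by apply: lt_le_trans cz.
  have cw0 : 0 < `|c w| by apply: lt_le_trans cw.
  rewrite /c' !indicE !mem_set// !mul1r.
  have -> : (c z)^-1 - (c w)^-1 = (c w - c z) / (c z * c w).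
    by field; rewrite -!normr_gt0 cz0 cw0.
  rewrite normrM normfV ltr_pdivrMr; last by rewrite normrM mulr_gt0.
  rewrite (lt_le_trans (Wc _ _ Ww Wz))// -mulrA ler_wpM2l ?(ltW e0)// normrM.
  by apply: ler_pM => //; exact: ltW.
- apply/funext => x; change (c x * (\1_U x * (c x)^-1) = \1_U x).
  rewrite indicE; have [/set_mem[e e0 /nbhs_singleton ce]|_] := boolP (x \in U).
    by rewrite mul1r divff// -normr_gt0 (lt_le_trans e0).
  by rewrite mul0r mulr0.
- apply/gnullP => e e0 O oO O0.
  have [UO0|UO] := pselect (U `&` O !=set0).
    exists (U `&` O); split => //; first exact: openI.
    move=> z [Uz _]; change (`|c z * \1_U z - c z| < e).
    by rewrite indicE mem_set// mulr1 subrr normr0.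
  have nU y : O y -> y \notin U.
    by move=> Oy; apply/negP => /set_mem Uy; apply: UO; exists y.
  have e20 : 0 < e / 2 by rewrite divr_gt0.
  have /gcontP/(_ _ e20 O oO O0) [W [oW W0 WO Wc]] := gc.
  have [w Ww cw] : exists2 w, W w & `|c w| < e / 2.
    apply: contrapT => nw; have [x Wx] := W0.
    apply: (negP (nU x (WO x Wx))); apply/mem_set; exists (e / 2) => //.
    apply: (filterS _ (open_nbhs_nbhs (conj oW Wx))) => z Wz.
    by rewrite leNgt; apply/negP => cz; apply: nw; exists z.
  exists W; split => // z Wz; change (`|c z * \1_U z - c z| < e).
  rewrite indicE (negbTE (nU _ (WO _ Wz))) mulr0 sub0r normrN.
  rewrite -(subrK (c w) (c z)) (splitr e) (le_lt_trans (ler_normD _ _))//.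
  by rewrite ltrD// Wc.
Qed.

Lemma hnf_quasi_inverse (a : @hnf R X) : exists U (oU : open U) a',
  a * a' = hindic oU /\ a * hindic oU = a.
Proof.
elim/(@hnf_ind R X): a => c gc.
have [U [c' [oU gc' cc' cU]]] := gcont_quasi_inverse gc.
exists U, oU, (hnf_of gc'); rewrite !mulrE_of; split; first exact: hnf_of_ext.
exact/hnf_of_eq.
Qed.

(** [D] consists of the open sets [O] such that [b * 1_O] lies in the ring;
    [F O] is this element, and [c] is the real function glued from the
    selections of the [F O]. *)
Theorem hnf_rationally_complete : rationally_complete (@hnf R X).
Proof.
move=> B i inj_i ratB; rewrite -subTset => b _.
pose D := [set O : set X | exists (oO : open O) f, b * i (hindic oO) = i f].
have D_quasi (a : hnf) : range i (b * i a) -> exists U (oU : open U),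
    D U /\ a * hindic oU = a.
  move=> [f _ fE]; have [U [oU [a' [aa' aU]]]] := hnf_quasi_inverse a.
  exists U, oU; split => //; exists oU, (f * a').
  by rewrite -aa' !rmorphM/= fE mulrA.
(* the union of D is dense: the characteristic function of an open set V
   disjoint from it kills all denominators of b, hence is 0 *)
pose cover := \bigcup_(O in D) O.
have ocover : open cover by apply: bigcup_open => O [].
have dcover : dense cover.
  move=> V V0 oV; apply: contrapT => VD.
  have [x Vx] := V0; suff : set0 x by [].
  rewrite -(hindic_eq0 (oO := oV))//; apply: inj_i; rewrite rmorph0.
  apply: ratB => _ [[a _ <-]] /D_quasi [U [oU [DU <-]]].
  rewrite -rmorphM mulrCA hindic_disjoint ?mulr0 ?rmorph0//.
  by rewrite -subset0 => z [Vz Uz]; apply: VD; exists z; split => //; exists U.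
(* 1_O depends formally on a proof that O is open, so F O has to work for
   all such proofs *)
have pickD O : exists f, D O -> forall oO : open O, b * i (hindic oO) = i f.
  have [[oO [f fE]]|nDO] := pselect (D O); last by exists 0 => /nDO.
  by exists f => _ oO'; rewrite (Prop_irrelevance oO' oO).
have [F FE] := choice pickD.
have Fcompat O V x : D O -> D V -> O x -> V x -> hval (F O) x = hval (F V) x.
  move=> DO DV Ox Vx; have [oO _] := DO; have [oV _] := DV.
  have oOV := openI oO oV.
  apply: (hval_local (oO := oOV)) => //; apply: inj_i.
  rewrite !rmorphM/= -(FE _ DO oO) -(FE _ DV oV) -!mulrA -!rmorphM/=.
  by congr (_ * i _); rewrite !mulrE_of; apply: hnf_of_ext; rewrite !indicM
    setICA setIid setIA setIid.
have pickx x : exists O, cover x -> D O /\ O x.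
  have [[V DV Vx]|nx] := pselect (cover x); first by exists V.
  by exists set0 => /nx.
have [cell cellP] := choice pickx.
pose c x := if `[< cover x >] then hrep (F (cell x)) x else 0.
have cE O x : D O -> O x -> c x = hrep (F O) x.
  move=> DO Ox; have cx : cover x by exists O.
  have [Dx xx] := cellP x cx.
  by rewrite /c asboolT// /hrep /rep (Fcompat _ O).
have gc : gcont c.
  apply: gcont_piecewise => V oV V0.
  have [x [Vx [U DU Ux]]] := dcover V V0 oV; have [oU _] := DU.
  exists (V `&` U), (hrep (F U)); split; [exact: openI|by exists x|by move=> ? []| |].
    exact: gcont_hrep.
  by move=> z [_ Uz]; exact: cE.
have cF O (oO : open O) : D O -> i (hnf_of gc * hindic oO) = b * i (hindic oO).
  move=> DO; have -> : b * i (hindic oO) = i (F O * hindic oO).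
    by rewrite rmorphM/= -(FE _ DO oO) -mulrA -rmorphM/= hindic_idem.
  congr (i _).
  have -> : F O = hnf_of (gcont_hrep (F O)).
    by apply: hval_inj; rewrite /= envelope_rep//; exact: hvalP.
  rewrite !mulrE_of; apply: hnf_of_ext; apply/funext => x.
  change (c x * \1_O x = hrep (F O) x * \1_O x); rewrite indicE.
  have [/set_mem Ox|_] := boolP (x \in O); last by rewrite !mulr0.
  by rewrite (cE O).
(* the class of c and b agree after multiplication by 1_U, and a = a * 1_U
   for every denominator a of b and a suitable U in D *)
exists (hnf_of gc) => //; apply/eqP; rewrite -subr_eq0; apply/eqP.
apply: (ratB b) => _ [[a _ <-]] /D_quasi [U [oU [DU <-]]].
by rewrite (mulrC a) rmorphM/= mulrBl !mulrA -rmorphM/= cF// subrr.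
Qed.

End RationalCompleteness.

Theorem theorem6 (R : realType) (X : topologicalType)
    (crX : completely_regular_space X) :
  exists (A : comPzRingType) (rho : A -> X -> set (\bar R)),
    is_Hnf_ring rho /\ rationally_complete A.
Proof.
exists (@hnf R X : comPzRingType), hval; split.
- exact: hval_is_Hnf_ring.
- exact: hnf_rationally_complete.
Qed.
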